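(* Let $n\geq 1$ and let $(a,\mathfrak{c})=(a,c_1,\ldots,c_n)\in(\mathbb{Z}_{>0})^{n+1}$ be a sequence for which $a>c_1\geq\cdots\geq c_n\geq 2$, $a\geq n+1$ and $a<c_1+\cdots+c_n$. Let $\mathcal{Q}^\sharp_{(a;\mathfrak{c})}\subset\mathbb{R}^n$ be the convex polytope of Veronese type defined by the system of linear inequalities $$0\leq x_i\leq c_i\ (i=1,\ldots,n),\qquad x_1+\cdots+x_n\leq a.$$ Then $\mathcal{Q}^\sharp_{(a;\mathfrak{c})}$ is level* if and only if every subset $\emptyset\neq X\subset[n]=\{1,\ldots,n\}$ satisfies neither $$a<\sum_{i\in X}c_i<a-n+2|X|-1$$ nor $$\sum_{i=1}^{n}c_i-\sum_{i\in X}c_i<a\leq 2|X|+\sum_{i=1}^{n}c_i-\sum_{i\in X}c_i-n.$$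
   Context: Inclusions $X\subset Y$ allow equality. A lattice polytope $\mathcal{P}\subset\mathbb{R}^n$ of dimension $n$ (all vertices in $\mathbb{Z}^n$) is normal if for each $N\geq 2$ every $\mathbf{a}\in N\mathcal{P}\cap\mathbb{Z}^n$ is a sum of $N$ elements of $\mathcal{P}\cap\mathbb{Z}^n$, where $N\mathcal{P}=\{N\mathbf{b}:\mathbf{b}\in\mathcal{P}\}$. A lattice polytope $\mathcal{P}\subset\mathbb{R}^n$ of dimension $n$ is level* if it is normal, $(\mathcal{P}\setminus\partial\mathcal{P})\cap\mathbb{Z}^n\neq\emptyset$, and for each $N\geq 2$ and each $\mathbf{a}\in N(\mathcal{P}\setminus\partial\mathcal{P})\cap\mathbb{Z}^n$ there exist $\mathbf{a}_0\in(\mathcal{P}\setminus\partial\mathcal{P})\cap\mathbb{Z}^n$ and $\mathbf{a}'\in(N-1)\mathcal{P}\cap\mathbb{Z}^n$ with $\mathbf{a}=\mathbf{a}_0+\mathbf{a}'$. Here $\mathcal{P}\setminus\partial\mathcal{P}$ is the interior of $\mathcal{P}$. *)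

(* Defs.v *)
From mathcomp Require Import all_boot all_order all_algebra.
From mathcomp Require Import all_classical all_reals all_analysis.
Import Order.TTheory GRing.Theory Num.Theory.
Import numFieldNormedType.Exports.

Set Implicit Arguments.
Unset Strict Implicit.
Unset Printing Implicit Defensive.

Local Open Scope classical_set_scope.
Local Open Scope ring_scope.

Section Polytopes.
Context {R : realType} {n : nat}.
Implicit Types (A P : set 'rV[R]_n) (x : 'rV[R]_n).

Definition lattice_points : set 'rV[R]_n :=
  [set x | forall i, x ord0 i \is a Num.int].

Definition convex_hull A : set 'rV[R]_n := smallest (@convex_set R 'rV[R]_n) A.

(* Closure under lines; as 2 is invertible in R, the nonempty affine sets are
   exactly the translates of linear subspaces. *)
Definition affine_set A :=
  forall x y (t : R), A x -> A y -> A (t *: x + (1 - t) *: y).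

Definition affine_hull A : set 'rV[R]_n := smallest affine_set A.

Definition has_dim P (d : nat) :=
  exists (x : 'rV[R]_n) (U : {vspace 'rV[R]_n}),
    \dim U = d /\ affine_hull P = [set x + u | u in [set` U]].

Definition polytope P :=
  exists V : set 'rV[R]_n, finite_set V /\ P = convex_hull V.

Definition vertices P : set 'rV[R]_n :=
  [set x | P x /\ forall y z (t : R), P y -> P z -> 0 < t < 1 ->
             x = t *: y + (1 - t) *: z -> y = x /\ z = x].

Definition lattice_polytope P := polytope P /\ vertices P `<=` lattice_points.

Definition dilate (N : nat) A : set 'rV[R]_n := [set N%:R *: x | x in A].

Definition normal_polytope P :=
  [/\ lattice_polytope P, has_dim P n &
      forall N : nat, (2 <= N)%N ->
      forall x, (dilate N P `&` lattice_points) x ->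
      exists y : 'I_N -> 'rV[R]_n,
        (forall k, (P `&` lattice_points) (y k)) /\ x = \sum_k y k].

Definition level_star P :=
  [/\ normal_polytope P,
      P° `&` lattice_points !=set0 &
      forall N : nat, (2 <= N)%N ->
      forall x, (dilate N P° `&` lattice_points) x ->
      exists x0 x' : 'rV[R]_n,
        [/\ (P° `&` lattice_points) x0,
            (dilate N.-1 P `&` lattice_points) x' & x = x0 + x']].

Definition veronese_polytope (a : nat) (c : 'I_n -> nat) : set 'rV[R]_n :=
  [set x | (forall i, 0 <= x ord0 i <= (c i)%:R)
           /\ \sum_(i < n) x ord0 i <= a%:R].

End Polytopes.

(* Main.v *)
Require Import Defs.
From mathcomp Require Import all_boot all_order all_algebra.
From mathcomp Require Import all_classical all_reals all_analysis.
From mathcomp Require Import zify ring lra.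
Import Order.TTheory GRing.Theory Num.Theory.
Import numFieldNormedType.Exports.

Local Open Scope ring_scope.

(** For a polytope of Veronese type both normality and the level condition say
    that a lattice point x of the N-th dilate P_N can be split as y + r, where
    y lies in P and r in P_(N-1); for the level condition x and y are moreover
    interior.  As the facets of P_N are given by the primitive functionals x_i,
    N c_i - x_i and N a - sum x, a lattice point is interior exactly when these
    integers are at least 1.  Both statements are thus cases (d = 0 and d = 1)
    of one question on integer vectors, where x and y have to stay at lattice
    distance d from every facet ([shrunk]).

    The summand y is constrained by an interval in each coordinate and by an
    interval for its sum.  By a discrete intermediate value argument
    ([sum_interpolation]) such a y exists as soon as the least admissible y has
    a sum that is not too large and the greatest one has a sum that is not too
    small.  Let v_X be the vertex of the box [0, c] equal to c on X and to 0
    elsewhere, and w_X the corresponding vertex of the shrunken box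
    [d, c - d].  Comparing the extreme y with w_X for a suitable X shows that y
    can fail to exist only if, for some X, v_X lies strictly on one side of the
    hyperplane sum = a and w_X strictly on the other side of the hyperplane
    sum = a - d ([shrunk_split]; [consistent] says that this is not so).  For
    d = 0 we have v_X = w_X, so that P is always normal.  Conversely, for
    d = 1 an X of this kind yields an interior lattice point of P_2 with no
    splitting ([split2_consistent]).  Since sum v_X is the sum of the c_i over
    X and sum w_X = sum v_X + n - 2 |X|, the two kinds of bad subset are those
    of the theorem, one of them after passing to the complement of X
    ([consistent_iff]).

    The remaining content of the level condition is geometric.  Adding the
    slack a - sum x as one more coordinate, the coordinates of a point of P sum
    to the integer a, so that a nonintegral point has two nonintegral
    coordinates; transferring mass between these in both directions writes it
    as a proper convex combination of points of P with fewer nonintegral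
    coordinates ([fractional_split]).  Hence P is the convex hull of its
    finitely many lattice points, and its vertices are integral. *)

(** * Splitting integer vectors *)

(** A discrete intermediate value theorem: starting from l, raise one coordinate
    by 1 at a time; as long as the sum is below that of u, some coordinate can
    still be raised. *)
Lemma sum_interpolation (I : finType) (l u : I -> int) (m : int) :
    (forall i, l i <= u i) -> \sum_i l i <= m <= \sum_i u i ->
  exists2 y : I -> int, (forall i, l i <= y i <= u i) & \sum_i y i = m.
Proof.
move=> le_lu /andP[le_lm le_mu].
have [k mE] : exists k : nat, m = \sum_i l i + k%:Z.
  by exists (absz (m - \sum_i l i)%R); lia.
elim: k m mE le_lm le_mu => [|k IHk] m -> le_lm le_mu.
  by exists l => [i|]; [rewrite lexx le_lu | rewrite addr0].
have [||y y_bd sum_y] := IHk _ erefl; [lia | lia |].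
have /existsP[i lt_yu] : [exists i, y i < u i].
  rewrite -[X in is_true X]negbK negb_exists; apply/negP => /forallP y_max.
  have: \sum_i u i <= \sum_i y i.
    by apply: ler_sum => i _; rewrite leNgt y_max.
  lia.
exists (fun j => y j + (j == i)%:Z).
  move=> j; have [->|_] := eqVneq j i; first by have := y_bd i; lia.
  by rewrite addr0 y_bd.
rewrite big_split /= sum_y -addrA; congr (_ + _).
rewrite (bigD1 i) //= eqxx big1 => [|j /negPf-> //]; lia.
Qed.

Section Integer.
Context {n : nat} (a : nat) (c : 'I_n -> nat).
Implicit Types (X : {set 'I_n}) (x y z : 'I_n -> int).

(** The lattice points of the N-th dilate of the polytope whose lattice distance
    to every facet is at least d: all of them for d = 0, and the interior ones
    for d = 1. *)
Definition shrunk (d N : nat) z :=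
  (forall i, d%:Z <= z i <= N%:Z * (c i)%:Z - d%:Z) /\
  \sum_i z i <= N%:Z * a%:Z - d%:Z.

(** The vertex of the box [d, c - d] which takes the upper bound on X; the
    vertices v_X and w_X of the introduction are [corner 0 X] and
    [corner d X]. *)
Definition corner (d : nat) X (i : 'I_n) : int :=
  if i \in X then (c i)%:Z - d%:Z else d%:Z.

Lemma sum_corner d X :
  \sum_i corner d X i =
  \sum_(i in X) (c i)%:Z + d%:Z * (n%:Z - 2 * #|X|%:Z).
Proof.
rewrite (eq_bigr (fun i =>
  d%:Z + if i \in X then (c i)%:Z - 2 * d%:Z else 0)); last first.
  by move=> i _; rewrite /corner; case: ifP; lia.
rewrite big_split -big_mkcond big_split !sumr_const card_ord /=.
rewrite !pmulrn !mulrzz; ring.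
Qed.

(** Moving from the box [0, c] and the hyperplane sum = a to the shrunken box and
    the hyperplane sum = a - d does not bring the vertex of X from one strict
    side to the other. *)
Definition consistent d X :=
  (\sum_i corner 0 X i < a%:Z -> \sum_i corner d X i <= a%:Z - d%:Z) /\
  (a%:Z < \sum_i corner 0 X i -> a%:Z - d%:Z <= \sum_i corner d X i).

(** The admissible y range between l and u, so by interpolation only the sums of
    l and u have to be bounded.  If the sum of l is too large, take for X the
    coordinates where l is attained by x - k c.  There x = l + k c, hence
    sum x >= sum l + k (sum v_X), and l <= w_X everywhere.
    A sum of l above a - d then makes w_X too large, so that consistency gives
    sum v_X >= a and sum x becomes larger than (k + 1) a - d.  The bound on u
    is obtained in the same way from the coordinates where u = c - d. *)
Lemma shrunk_split (d k : nat) x :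
    (forall i, 2 * d <= c i)%N -> (forall X, consistent d X) -> (0 < k)%N ->
    shrunk d k.+1 x ->
  exists2 y, shrunk d 1 y & shrunk 0 k (fun i => x i - y i).
Proof.
move=> c_ge cons k_gt0 [x_bd x_sum].
have kc_ge0 i : 0 <= k%:Z * (c i)%:Z by [].
pose l (i : 'I_n) : int := Num.max d%:Z (x i - k%:Z * (c i)%:Z).
pose u (i : 'I_n) : int := Num.min ((c i)%:Z - d%:Z) (x i).
have le_lu i : l i <= u i.
  by rewrite /l /u; have := x_bd i; have := c_ge i; have := kc_ge0 i; lia.
have l_le : \sum_i l i <= a%:Z - d%:Z.
  pose X := [set i | d%:Z <= x i - k%:Z * (c i)%:Z].
  have lw : \sum_i l i <= \sum_i corner d X i.
    apply: ler_sum => i _; rewrite /l /corner inE.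
    by have := x_bd i; have := kc_ge0 i; case: ifP; lia.
  have lx : \sum_i l i + k%:Z * \sum_i corner 0 X i <= \sum_i x i.
    rewrite mulr_sumr -big_split; apply: ler_sum => i _ /=.
    by rewrite /l /corner inE; have := x_bd i; have := kc_ge0 i; case: ifP; lia.
  (* By contradiction: consistency turns w_X too large into sum v_X >= a. *)
  have [small _] := cons X; rewrite leNgt; apply/negP => l_gt.
  have: k%:Z * a%:Z <= k%:Z * \sum_i corner 0 X i by rewrite ler_pM2l //; lia.
  lia.
have u_ge : \sum_i x i - k%:Z * a%:Z <= \sum_i u i.
  pose X := [set i | (c i)%:Z - d%:Z <= x i].
  have uw : \sum_i corner d X i <= \sum_i u i.
    apply: ler_sum => i _; rewrite /u /corner inE.
    by have := x_bd i; have := kc_ge0 i; case: ifP; lia.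
  have ux : \sum_i x i <= \sum_i u i + k%:Z * \sum_i corner 0 X i.
    rewrite mulr_sumr -big_split; apply: ler_sum => i _ /=.
    by rewrite /u /corner inE; have := x_bd i; have := kc_ge0 i; case: ifP; lia.
  (* A small sum of u forces sum v_X > a, whence w_X is large, and so is u. *)
  have [_ big] := cons X; rewrite leNgt; apply/negP => u_lt.
  have: k%:Z * a%:Z < k%:Z * \sum_i corner 0 X i by lia.
  by rewrite ltr_pM2l // => /big; lia.
have sum_lu : \sum_i l i <= \sum_i u i by apply: ler_sum.
have [||y y_bd y_sum] := @sum_interpolation _ l u
    (Num.max (\sum_i l i) (\sum_i x i - k%:Z * a%:Z)); first done.
  by rewrite le_max lexx /= ge_max sum_lu u_ge.
have y_le : \sum_i y i <= a%:Z - d%:Z by rewrite y_sum ge_max l_le andTb; lia.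
have y_ge : \sum_i x i - k%:Z * a%:Z <= \sum_i y i.
  by rewrite y_sum le_max lexx orbT.
exists y; split.
- by move=> i; have := y_bd i; have := kc_ge0 i; rewrite /l /u; lia.
- by rewrite mul1r.
- by move=> i; have := y_bd i; have := kc_ge0 i; rewrite /l /u; lia.
- by rewrite sumrB subr0 lerBlDr addrC -lerBlDr.
Qed.

Lemma shrunk0_sum N x : shrunk 0 N.+1 x ->
  exists y : 'I_N.+1 -> 'I_n -> int,
    (forall k, shrunk 0 1 (y k)) /\ forall i, x i = \sum_k y k i.
Proof.
elim: N x => [|N IHN] x x_in.
  by exists (fun=> x); split=> // i; rewrite big_ord1.
have [||y y_in /IHN[ys [ys_in ysE]]] := @shrunk_split 0 N.+1 x _ _ isT x_in.
- by [].
- by move=> X; split; rewrite subr0; lia.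
exists (fun k => if unlift ord0 k is Some j then ys j else y); split.
  by move=> k; case: unliftP.
move=> i; rewrite big_ord_recl unlift_none.
under eq_bigr do rewrite liftK.
by rewrite -ysE addrC subrK.
Qed.

(** If v_X is below the hyperplane and w_X is not, some z between the constant 1
    and w_X has sum a; the interior summand of z + v_X is then at least z in
    each coordinate, which is too much.  If v_X is above the hyperplane and w_X
    is too small, some e between 0 and v_X has sum a + 1; the interior summand
    of w_X + e is at most w_X, which leaves a remainder of sum more than a. *)
Lemma split2_consistent X :
    (n < a)%N -> (forall i, 2 <= c i)%N ->
    (forall x, shrunk 1 2 x ->
      exists2 y, shrunk 1 1 y & shrunk 0 1 (fun i => x i - y i)) ->
  consistent 1 X.
Proof.
move=> n_lt c_ge split2; split=> C; rewrite leNgt; apply/negP => W.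
- have [||z z_bd z_sum] :=
      @sum_interpolation _ (fun _ : 'I_n => 1) (corner 1 X) a%:Z.
  + by move=> i; rewrite /corner; have := c_ge i; case: ifP; lia.
  + by rewrite sumr_const card_ord natz; lia.
  have x_sum : \sum_i (z i + corner 0 X i) = a%:Z + \sum_i corner 0 X i.
    by rewrite big_split z_sum.
  have [|y [y_bd y_sum] [r_bd _]] := split2 (fun i => z i + corner 0 X i).
    split; last by rewrite x_sum; lia.
    move=> i; have := z_bd i; have := c_ge i.
    by rewrite /corner; case: ifP; lia.
  suff: \sum_i z i <= \sum_i y i by lia.
  apply: ler_sum => i _; have := z_bd i; have := y_bd i; have := r_bd i.
  by rewrite /corner; case: ifP; lia.
- have [||e e_bd e_sum] :=
      @sum_interpolation _ (fun _ : 'I_n => 0) (corner 0 X) (a%:Z + 1).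
  + by move=> i; rewrite /corner; case: ifP; lia.
  + by rewrite big1 //; lia.
  have x_sum : \sum_i (corner 1 X i + e i) = \sum_i corner 1 X i + (a%:Z + 1).
    by rewrite big_split e_sum.
  have [|y [y_bd y_sum] [r_bd r_sum]] := split2 (fun i => corner 1 X i + e i).
    split; last by rewrite x_sum; lia.
    move=> i; have := e_bd i; have := c_ge i.
    by rewrite /corner; case: ifP; lia.
  have y_le : \sum_i y i <= \sum_i corner 1 X i.
    apply: ler_sum => i _; have := e_bd i; have := y_bd i; have := r_bd i.
    by rewrite /corner; case: ifP; lia.
  move: r_sum; rewrite sumrB x_sum lerBlDr =>
    /le_trans/(_ (lerD (lexx _) y_le)).
  lia.
Qed.

End Integer.

Section Geometry.
Local Open Scope classical_set_scope.
Context {R : realType} {n : nat} (a : nat) (c : 'I_n -> nat).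
Implicit Types (x y : 'rV[R]_n) (z : 'I_n -> int).
Local Notation P := (veronese_polytope a c : set 'rV[R]_n).

(** * Lattice points and interior *)

Definition int_row z : 'rV[R]_n := \row_i (z i)%:~R.

Lemma int_row_lattice z : lattice_points (int_row z).
Proof. by move=> i; rewrite mxE intr_int. Qed.

Lemma lattice_int_row x : lattice_points x -> exists z, x = int_row z.
Proof.
move=> x_int; exists (fun i => Num.floor (x ord0 i)).
by apply/rowP => i; rewrite mxE floorK ?x_int.
Qed.

Lemma sum_int_row z : \sum_i int_row z ord0 i = (\sum_i z i)%:~R.
Proof. by rewrite rmorph_sum; apply: eq_bigr => i _; rewrite mxE. Qed.

Definition open_veronese : set 'rV[R]_n :=
  [set x | (forall i, 0 < x ord0 i < (c i)%:R) /\ \sum_i x ord0 i < a%:R].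

Lemma sum_continuous : continuous (fun x : 'rV[R]_n => \sum_i x ord0 i).
Proof.
move=> x; apply: cvg_big => [||i _].
- exact: add_continuous.
- exact: nbhs_filter.
- exact: coord_continuous.
Qed.

(** Along a unit vector, in one direction or the other, every defining
    inequality gets tighter; an interior point can be nudged in these
    directions, so that none of them is an equality there. *)
Lemma interior_veronese : (0 < n)%N -> P° = open_veronese.
Proof.
move=> n_gt0; apply/seteqP; split=> x; last first.
  move=> [x_bd x_sum]; rewrite /interior /=.
  near=> y; split=> [i|]; last first.
    near: y; apply: filterS (cvgr_lt _ (sum_continuous x) _ x_sum) => y.
    exact: ltW.
  move: i; near: y; apply: filter_forall => i; have /andP[x_gt0 x_lt] := x_bd i.
  near=> y; apply/andP; split; apply: ltW; near: y.
    exact: (cvgr_gt _ (@coord_continuous _ _ _ ord0 i x) _ x_gt0).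
  exact: (cvgr_lt _ (@coord_continuous _ _ _ ord0 i x) _ x_lt).
move=> /nbhs_ballP[e /= e_gt0 ballP].
have nudge i s : `|s| < e -> P (x + s *: delta_mx ord0 i).
  move=> s_lt; apply: ballP; split=> // k j.
  rewrite !mxE /ball /= opprD addrA subrr add0r normrN normrM.
  rewrite ord1 eqxx /= (le_lt_trans _ s_lt) // ler_piMr //.
  by case: eqP => _; rewrite ?normr1 ?normr0.
have coord i s : (x + s *: delta_mx ord0 i) ord0 i = x ord0 i + s.
  by rewrite !mxE !eqxx mulr1.
have half_e : `|e / 2| < e by rewrite gtr0_norm; lra.
split=> [i|].
  have [/(_ i) + _] := nudge i _ half_e.
  have [/(_ i) + _] := nudge i (- (e / 2)) ltac:(by rewrite normrN).
  by rewrite !coord; lra.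
have [_] := nudge (Ordinal n_gt0) _ half_e.
apply: lt_le_trans; rewrite -subr_gt0 -sumrB.
rewrite (bigD1 (Ordinal n_gt0)) //= coord big1 => [|j /negPf j_neq].
  by lra.
by rewrite !mxE j_neq andbF mulr0 addr0 subrr.
Unshelve. all: by end_near. Qed.

Lemma dilateE (A : set 'rV[R]_n) N x :
  (0 < N)%N -> dilate N A x <-> A (N%:R^-1 *: x).
Proof.
move=> N_gt0; have N_neq0 : N%:R != 0 :> R by rewrite pnatr_eq0 -lt0n.
split=> [[y Ay <-]|Ax]; first by rewrite scalerA mulVf // scale1r.
by exists (N%:R^-1 *: x) => //; rewrite scalerA mulfV // scale1r.
Qed.

Lemma dilate1 (A : set 'rV[R]_n) : dilate 1 A = A.
Proof. by apply/seteqP; split=> x; rewrite dilateE ?invr1 ?scale1r. Qed.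

(** The strict bounds are restated with a unit margin because k and N * m are
    integers; this is what makes interior lattice points those at lattice
    distance at least 1 from the facets. *)
Lemma scaled_bounds (N : nat) (k : int) (m : nat) : (0 < N)%N ->
  [/\ (0 <= N%:R^-1 * k%:~R :> R) = (0 <= k),
      (0 < N%:R^-1 * k%:~R :> R) = (1%:Z <= k),
      (N%:R^-1 * k%:~R <= m%:R :> R) = (k <= N%:Z * m%:Z) &
      (N%:R^-1 * k%:~R < m%:R :> R) = (k <= N%:Z * m%:Z - 1%:Z)].
Proof.
move=> N_gt0; have N_pos : 0 < N%:R :> R by rewrite ltr0n.
have NmE : N%:R * m%:R = (N%:Z * m%:Z)%:~R :> R by rewrite intrM.
rewrite pmulr_rge0 ?invr_gt0 // pmulr_rgt0 ?invr_gt0 //.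
rewrite ler_pdivrMl // ltr_pdivrMl // NmE.
by rewrite ler0z ltr0z ler_int ltr_int; split=> //; lia.
Qed.

Lemma dilate_veronese_int N z :
  (0 < N)%N -> dilate N P (int_row z) <-> shrunk a c 0 N z.
Proof.
move=> N_gt0; rewrite dilateE // /veronese_polytope /shrunk /=.
have -> : \sum_i (N%:R^-1 *: int_row z) ord0 i =
    N%:R^-1 * (\sum_i z i)%:~R.
  by rewrite -sum_int_row mulr_sumr; apply: eq_bigr => i _; rewrite mxE.
have [_ _ -> _] := scaled_bounds N (\sum_i z i) a N_gt0; rewrite subr0.
split=> -[z_bd z_sum]; split=> // i; have := z_bd i;
  have [+ _ + _] := scaled_bounds N (z i) (c i) N_gt0;
  by rewrite !mxE subr0 => -> ->.
Qed.

Lemma dilate_open_veronese_int N z :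
  (0 < N)%N -> dilate N open_veronese (int_row z) <-> shrunk a c 1 N z.
Proof.
move=> N_gt0; rewrite dilateE // /open_veronese /shrunk /=.
have -> : \sum_i (N%:R^-1 *: int_row z) ord0 i =
    N%:R^-1 * (\sum_i z i)%:~R.
  by rewrite -sum_int_row mulr_sumr; apply: eq_bigr => i _; rewrite mxE.
have [_ _ _ ->] := scaled_bounds N (\sum_i z i) a N_gt0.
split=> -[z_bd z_sum]; split=> // i; have := z_bd i;
  have [_ + _ +] := scaled_bounds N (z i) (c i) N_gt0;
  by rewrite !mxE => -> ->.
Qed.

(** * Integrality of the polytope *)

(** Homogeneous coordinates: the index [None] carries the slack of the
    inequality on the sum, which puts that inequality on the same footing as
    x_i >= 0. *)
Definition homog x (o : option 'I_n) : R :=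
  if o is Some i then x ord0 i else a%:R - \sum_i x ord0 i.

(** The slack is at most a as the coordinates are nonnegative, so that all
    homogeneous coordinates have an integral upper bound. *)
Definition cap (o : option 'I_n) : nat := if o is Some i then c i else a.

Lemma veronese_homog x : P x <-> forall o, 0 <= homog x o <= (cap o)%:R.
Proof.
split=> [[x_bd x_sum] [i|] //=|x_bd].
  have : 0 <= \sum_i x ord0 i.
    by apply: sumr_ge0 => i _; have /andP[] := x_bd i.
  by lra.
by split=> [i|]; [exact: (x_bd (Some i)) | have /= := x_bd None; lra].
Qed.

Lemma sum_homog x : \sum_o homog x o = a%:R.
Proof.
rewrite (bigD1 None) //= (reindex_omap Some id) => [|[] //].
rewrite [X in _ + X](eq_bigl predT) => [|i]; first by rewrite subrK.
by rewrite /= eqxx.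
Qed.

(** The direction which moves one unit of homogeneous mass from [o2] to [o1]. *)
Definition transfer (o1 o2 : option 'I_n) : 'rV[R]_n :=
  \row_i ((Some i == o1)%:R - (Some i == o2)%:R).

Lemma homog_transfer x (s : R) o1 o2 o :
  homog (x + s *: transfer o1 o2) o =
  homog x o + s * ((o == o1)%:R - (o == o2)%:R).
Proof.
case: o => [i|] /=; first by rewrite !mxE.
have sum_hit o :
    \sum_i (Some i == o :> option 'I_n)%:R = 1 - (None == o)%:R :> R.
  case: o => [j|]; last by rewrite big1 // subrr.
  rewrite (bigD1 j) //= eqxx big1 ?addr0 ?subr0 // => i /negPf ij.
  by rewrite (inj_eq Some_inj) ij.
have -> : \sum_i (x + s *: transfer o1 o2) ord0 i =
    \sum_i x ord0 i + s * (\sum_i (Some i == o1)%:R - \sum_i (Some i == o2)%:R).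
  rewrite -sumrB mulr_sumr -big_split; apply: eq_bigr => i _ /=.
  by rewrite !mxE.
by rewrite !sum_hit; ring.
Qed.

Definition fractional x : {set option 'I_n} :=
  [set o | homog x o \isn't a Num.int]%SET.

Lemma fractional0 x : (fractional x = finset.set0) <-> lattice_points x.
Proof.
split=> [x0 i|x_int].
  by have := finset.in_set0 (Some i); rewrite -x0 inE => /negbFE.
apply/setP => o; rewrite !inE; apply/negbTE; rewrite negbK.
case: o => [i|]; first exact: x_int.
by rewrite /= rpredB ?rpred_nat // rpred_sum // => i _; apply: x_int.
Qed.

(** The homogeneous coordinates have an integral sum, so that they cannot
    all but one be integers. *)
Lemma two_fractional x o1 : o1 \in fractional x ->
  exists2 o2, o2 \in fractional x & o2 != o1.
Proof.
move=> fr1; apply/exists_inP; move: fr1; rewrite inE; apply: contraR.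
move=> /exists_inPn other_int.
have -> : homog x o1 = a%:R - \sum_(o | o != o1) homog x o.
  by rewrite -(sum_homog x) (bigD1 o1) //= addrK.
rewrite rpredB ?rpred_nat // rpred_sum // => o; apply: contraNT => o_frac.
by apply/negbNE/other_int; rewrite inE.
Qed.

Lemma floor_ceil_lt (r : R) : r \isn't a Num.int ->
  (Num.floor r)%:~R < r < (Num.ceil r)%:~R.
Proof.
move=> r_frac; rewrite !lt_neqAle floor_le -ceil_le_int lexx !andbT.
apply/andP; split; apply: contraNneq r_frac.
  by move=> <-; apply: intr_int.
by move=> ->; apply: intr_int.
Qed.

(** Transfer mass until one of the two coordinates hits an integer.  The bounds
    are integers and both coordinates stay between their floor and their
    ceiling, so that no bound is crossed on the way. *)
Lemma transfer_to_int x o1 o2 : P x -> o1 != o2 ->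
    o1 \in fractional x -> o2 \in fractional x ->
  exists s : R, [/\ 0 < s, P (x + s *: transfer o1 o2) &
    fractional (x + s *: transfer o1 o2) \proper fractional x].
Proof.
move=> /veronese_homog Px o12 fr1 fr2.
have := fr1; rewrite inE => /floor_ceil_lt/andP[_ lt_ceil].
have := fr2; rewrite inE => /floor_ceil_lt/andP[lt_floor _].
pose u := (Num.ceil (homog x o1))%:~R - homog x o1.
pose v := homog x o2 - (Num.floor (homog x o2))%:~R.
(* s is the first time at which one of the two coordinates is integral. *)
pose s := Num.min u v; pose y := x + s *: transfer o1 o2.
have s_gt0 : 0 < s by rewrite lt_min !subr_gt0 lt_ceil lt_floor.
have su : s <= u by rewrite ge_min lexx.
have sv : s <= v by rewrite ge_min lexx orbT.
have y1 : homog y o1 = homog x o1 + s.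
  by rewrite homog_transfer eqxx (negPf o12) subr0 mulr1.
have y2 : homog y o2 = homog x o2 - s.
  by rewrite homog_transfer eqxx eq_sym (negPf o12) sub0r mulrN1.
have y_other o : o != o1 -> o != o2 -> homog y o = homog x o.
  by move=> /negPf o1E /negPf o2E;
    rewrite homog_transfer o1E o2E subrr mulr0 addr0.
exists s; rewrite -/y; split=> //.
  apply/veronese_homog => o; have := Px o.
  have [->|o_neq1] := eqVneq o o1.
    have: (Num.ceil (homog x o1))%:~R <= (cap o1)%:R :> R.
      by rewrite pmulrn ler_int ceil_le_int; have /andP[] := Px o1.
    by rewrite y1; move: su; rewrite /u; lra.
  have [->|o_neq2] := eqVneq o o2; last by rewrite y_other.
  have: 0 <= (Num.floor (homog x o2))%:~R :> R.
    by rewrite ler0z floor_ge_int; have /andP[] := Px o2.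
  by rewrite y2; move: sv; rewrite /v; lra.
apply/properP; split.
  apply/fintype.subsetP => o; rewrite [in X in X -> _]inE.
  have [->//|o_neq1] := eqVneq o o1; have [->//|o_neq2] := eqVneq o o2.
  by rewrite y_other // inE.
have [uv|vu] := leP u v; [exists o1 | exists o2]; rewrite // inE negbK.
  by rewrite y1 /s min_l // addrC subrK intr_int.
by rewrite y2 /s min_r ?ltW // opprB addrC subrK intr_int.
Qed.

(** Moving along the line through two nonintegral coordinates, in both
    directions, gives two points of which x is a proper convex combination.
    Properness serves to exclude that x is a vertex, and the decrease of the set
    of nonintegral coordinates to argue by induction. *)
Lemma fractional_split x : P x -> ~ lattice_points x ->
  exists y w (t : R), [/\ P y, P w, 0 < t < 1, x = t *: y + (1 - t) *: w &
    (fractional y \proper fractional x) && (fractional w \proper fractional x)].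
Proof.
move=> Px x_frac.
have /set0Pn[p fr1] : fractional x != finset.set0.
  by apply/eqP => /fractional0.
have [q fr2 qp] := two_fractional x p fr1.
have [|s [s_gt0 Py fr_y]] := transfer_to_int x p q Px _ fr1 fr2.
  by rewrite eq_sym.
have [r [r_gt0 Pw fr_w]] := transfer_to_int x q p Px qp fr2 fr1.
exists (x + s *: transfer p q), (x + r *: transfer q p), (r / (s + r)).
split=> //; last by rewrite fr_y fr_w.
  by rewrite divr_gt0 ?addr_gt0 // ltr_pdivrMr ?addr_gt0 // mul1r ltrDr.
have -> : transfer q p = - transfer p q by apply/rowP => i; rewrite !mxE opprB.
apply/rowP => i; rewrite !mxE; field.
by rewrite gt_eqF // addr_gt0.
Qed.

Lemma veronese_conv x y (t : R) :
  P x -> P y -> 0 <= t <= 1 -> P (t *: x + (1 - t) *: y).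
Proof.
move=> [x_bd x_sum] [y_bd y_sum] t01; split=> [i|].
  by rewrite !mxE; have := x_bd i; have := y_bd i; nra.
have -> : \sum_i (t *: x + (1 - t) *: y) ord0 i =
    t * \sum_i x ord0 i + (1 - t) * \sum_i y ord0 i.
  by rewrite !mulr_sumr -big_split; apply: eq_bigr => i _; rewrite !mxE.
by nra.
Qed.

(** By induction on the number of nonintegral homogeneous coordinates. *)
Lemma veronese_hull : P = convex_hull (P `&` lattice_points).
Proof.
apply/seteqP; split=> x; last first.
  apply: smallest_sub; last by move=> ? [].
  move=> y z k; rewrite !inE => Py Pz.
  by apply: veronese_conv => //; rewrite ge0 le1.
move=> Px M /= [M_conv M_lat].
have [m] := ubnP #|fractional x|; elim: m x Px => // m IHm x Px.
rewrite ltnS => le_m.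
have [x_lat|x_frac] := pselect (lattice_points x); first exact: M_lat.
have [y [z [t [Py Pz /andP[t0 t1] xE /andP[fr_y fr_z]]]]] :=
  fractional_split x Px x_frac.
have My : y \in M.
  by rewrite inE; apply: IHm => //; apply: leq_trans (proper_card fr_y) le_m.
have Mz : z \in M.
  by rewrite inE; apply: IHm => //; apply: leq_trans (proper_card fr_z) le_m.
rewrite xE; exact: (set_mem (M_conv y z (Itv01 (ltW t0) (ltW t1)) My Mz)).
Qed.

Lemma finite_veronese_lattice : finite_set (P `&` lattice_points).
Proof.
apply: (@sub_finite_set _ _
  [set (\row_i (f i : nat)%:R : 'rV[R]_n) | f in
    [set: {ffun 'I_n -> 'I_(\max_i c i).+1}]]).
  move=> x [[x_bd _] x_lat]; have [z zE] := lattice_int_row x x_lat.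
  exists [ffun i => inord (absz (z i))] => //; apply/rowP => i.
  have := x_bd i; rewrite zE !mxE ffunE ler0z pmulrn ler_int => z_bd.
  rewrite inordK; first by rewrite natr_absz ger0_norm //; case/andP: z_bd.
  by rewrite ltnS (leq_trans _ (leq_bigmax i)) //; lia.
exact/finite_image/finite_finset.
Qed.

Lemma veronese_lattice_polytope : lattice_polytope P.
Proof.
split.
  exists (P `&` lattice_points); split; last exact: veronese_hull.
  exact: finite_veronese_lattice.
move=> x [Px x_ext]; apply: contrapT => x_frac.
have [y [z [t [Py Pz t01 xE /andP[fr_y _]]]]] := fractional_split x Px x_frac.
have [y_eq _] := x_ext _ _ _ Py Pz t01 xE.
by move: fr_y; rewrite y_eq fintype.properxx.
Qed.

(** The polytope contains 0 and the unit vectors, and an affine set with these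
    points is the whole space. *)
Lemma veronese_dim : (0 < a)%N -> (forall i, 0 < c i)%N -> has_dim P n.
Proof.
move=> a_gt0 c_gt0; exists 0, fullv; split.
  by rewrite dimvf dim_matrix mul1r.
apply/seteqP; split=> x _; first by exists x; [exact: memvf | exact: add0r].
move=> M /= [M_aff PM].
have P0 : P 0.
  by split=> [i|]; rewrite ?big1 // => *; rewrite !mxE ?lexx ?ler0n.
have M0 := PM _ P0.
have MZ t y : M y -> M (t *: y).
  by move=> My; have := M_aff _ _ t My M0; rewrite scaler0 addr0.
have MD y w : M y -> M w -> M (y + w).
  (* The sum is the midpoint of the doubles. *)
  move=> My Mw; have := M_aff _ _ (1 / 2) (MZ 2 _ My) (MZ 2 _ Mw).
  by rewrite !scalerA; congr (M (_ + _)); rewrite -[RHS]scale1r;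
    congr (_ *: _); lra.
rewrite (row_sum_delta x); elim/big_ind: _ => // i _; apply/MZ/PM.
split=> [j|].
  by rewrite !mxE eqxx /=; case: eqP; rewrite ?ler01 ?ler1n ?lexx ?ler0n ?c_gt0.
rewrite (bigD1 i) //= big1 => [|j /negPf ij]; rewrite !mxE eqxx ?ij //=.
by rewrite addr0 ?eqxx ler1n.
Qed.

End Geometry.

Section Level.
Local Open Scope classical_set_scope.
Context {R : realType} {n : nat} (a : nat) (c : 'I_n -> nat).
Implicit Types (x y z : 'I_n -> int).
Local Notation P := (veronese_polytope a c : set 'rV[R]_n).

(** * Normality and the level condition *)

Lemma int_rowB x y :
  int_row (fun i => x i - y i) = int_row x - int_row y :> 'rV[R]_n.
Proof. by apply/rowP => i; rewrite !mxE intrB. Qed.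

Lemma veronese_int z : P (int_row z) <-> shrunk a c 0 1 z.
Proof. by rewrite -(@dilate_veronese_int R) // dilate1. Qed.

Lemma interior_veronese_int z :
  (0 < n)%N -> P° (int_row z) <-> shrunk a c 1 1 z.
Proof.
move=> n_gt0.
by rewrite -(@dilate_open_veronese_int R) // dilate1 interior_veronese.
Qed.

(** Normality is the splitting for d = 0, applied repeatedly. *)
Lemma veronese_normal :
  (0 < a)%N -> (forall i, 0 < c i)%N -> normal_polytope P.
Proof.
move=> a_gt0 c_gt0; split; first exact: veronese_lattice_polytope.
  exact: veronese_dim.
case=> [|N] // _ x [x_in /lattice_int_row[z zE]].
move: x_in; rewrite zE dilate_veronese_int // => /shrunk0_sum[ys [ys_in ysE]].
exists (fun k => int_row (ys k)); split=> [k|].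
  by split; [apply/veronese_int | exact: int_row_lattice].
apply/rowP => i; rewrite summxE mxE ysE rmorph_sum.
by apply: eq_bigr => k _; rewrite mxE.
Qed.

Lemma level_star_consistent :
    (0 < n)%N -> (n < a)%N -> (forall i, 2 <= c i)%N ->
  level_star P <-> forall X, consistent a c 1 X.
Proof.
move=> n_gt0 n_lt_a c_ge2; split=> [[_ _ level] X|cons].
  apply: split2_consistent => // x x_in.
  have [|x0 [x' [[x0_in /lattice_int_row[y yE]] [x'_in _] xE]]] :=
      level 2%N isT (int_row x).
    split; last exact: int_row_lattice.
    by rewrite interior_veronese // dilate_open_veronese_int.
  exists y; first by apply/interior_veronese_int; rewrite -?yE.
  apply/veronese_int; rewrite int_rowB xE yE addrC addKr.
  by rewrite -[P]dilate1.
split.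
- by apply: veronese_normal => [|i]; [lia | apply: leq_trans (c_ge2 i)].
(* The all-ones vector is interior because n < a and 2 <= c. *)
- exists (int_row (fun=> 1)); split; last exact: int_row_lattice.
  apply/interior_veronese_int => //; split=> [i|].
    by have := c_ge2 i; lia.
  by rewrite sumr_const card_ord natz; lia.
- case=> [|[|k]] // _ x [x_in /lattice_int_row[z zE]].
  have z_in : shrunk a c 1 k.+2 z.
    apply/(@dilate_open_veronese_int R) => //.
    by rewrite -interior_veronese // -zE.
  have [//|//|y y_in r_in] := shrunk_split a c 1 k.+1 z _ cons _ z_in.
  exists (int_row y), (int_row (fun i => z i - y i)); split.
  + by split; [apply/interior_veronese_int | exact: int_row_lattice].
  + by split; [apply/dilate_veronese_int | exact: int_row_lattice].
  + by rewrite zE int_rowB addrC subrK.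
Qed.

(** A bad X with the sum of c over X above a is of the first kind in the
    theorem, and a bad X with that sum below a has a complement of the second
    kind.  These two sets are nonempty, because the sum over the empty set is
    not above a and the total sum is not below a. *)
Lemma consistent_iff :
    (a < \sum_(i < n) c i)%N ->
  (forall X, consistent a c 1 X) <->
  forall X : {set 'I_n}, X != finset.set0 ->
    ~ (a%:Z < \sum_(i in X) (c i)%:Z < a%:Z - n%:Z + 2 * #|X|%:Z - 1) /\
    ~ (\sum_(i < n) (c i)%:Z - \sum_(i in X) (c i)%:Z < a%:Z
       <= 2 * #|X|%:Z + \sum_(i < n) (c i)%:Z - \sum_(i in X) (c i)%:Z - n%:Z).
Proof.
move=> a_lt; have a_lt_sum : a%:Z < \sum_(i < n) (c i)%:Z.
  by rewrite -(big_morph Posz PoszD (erefl _)) ltz_nat.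
have cardC (X : {set 'I_n}) : #|~: X|%:Z = n%:Z - #|X|%:Z.
  by have := cardsC X; rewrite card_ord; lia.
have sumC (X : {set 'I_n}) : \sum_(i in ~: X) (c i)%:Z =
    \sum_(i < n) (c i)%:Z - \sum_(i in X) (c i)%:Z.
  rewrite [\sum_(i < n) _](bigID (fun i => i \in X)) /= addrAC subrr add0r.
  by apply: eq_bigl => i; rewrite inE.
rewrite /consistent; split=> [cons X _|bad X].
  have [_] := cons X; have [+ _] := cons (~: X).
  by rewrite !sum_corner sumC cardC => C1 C2; split; lia.
rewrite !sum_corner; split=> C.
  have X'_neq0 : ~: X != finset.set0.
    apply/negP => /eqP X'0; have := sumC X; rewrite X'0 big_set0; lia.
  by have [_] := bad _ X'_neq0; rewrite sumC cardC; lia.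
have X_neq0 : X != finset.set0.
  by apply: contraTneq C => ->; rewrite big_set0; lia.
by have [+ _] := bad _ X_neq0; lia.
Qed.

End Level.

Theorem theorem3p2 (R : realType) (n : nat) (n_gt0 : (1 <= n)%N)
    (a : nat) (c : 'I_n -> nat)
    (a_gt0 : (0 < a)%N) (c_gt0 : forall i, (0 < c i)%N)
    (c_lt_a : forall i, (c i < a)%N)
    (c_noninc : forall i j : 'I_n, (i <= j)%N -> (c j <= c i)%N)
    (c_ge2 : forall i, (2 <= c i)%N)
    (a_ge : (n + 1 <= a)%N)
    (a_lt_sum : (a < \sum_(i < n) c i)%N) :
  level_star (veronese_polytope a c : set 'rV[R]_n) <->
  forall X : {set 'I_n}, X != finset.set0 ->
    ~ (a%:Z < \sum_(i in X) (c i)%:Z < a%:Z - n%:Z + 2 * #|X|%:Z - 1) /\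
    ~ (\sum_(i < n) (c i)%:Z - \sum_(i in X) (c i)%:Z < a%:Z
       <= 2 * #|X|%:Z + \sum_(i < n) (c i)%:Z - \sum_(i in X) (c i)%:Z - n%:Z).
Proof.
have n_lt_a : (n < a)%N by rewrite -addn1.
apply: iff_trans (level_star_consistent a c n_gt0 n_lt_a c_ge2) _.
exact: consistent_iff.
Qed.
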